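(* Let $\mathcal M(2)=(\mathcal P,\mathcal Z)$ be a Möbius plane of order $2$ and let $S$ be a split-resolving set of minimum cardinality of its point-circle incidence graph. Then $|S\cap\mathcal P|=4$ and $|S\cap\mathcal Z|=3$.
   Context: A Möbius plane is a pair $(\mathcal P,\mathcal Z)$, where $\mathcal P$ is a set (of points) and $\mathcal Z$ is a set of subsets of $\mathcal P$ (circles), such that: (i) any three pairwise distinct points lie on exactly one circle; (ii) if $z\in\mathcal Z$, $P\in z$ and $Q\in\mathcal P\setminus z$, there is exactly one circle $z'$ through $P$ and $Q$ with $z\cap z'=\{P\}$; (iii) there is at least one circle and every circle has at least three points; (iv) for every circle $z$ there is a point not on $z$. A finite Möbius plane has order $q$ if every circle has $q+1$ points. The point-circle incidence graph has vertex set $\mathcal P\cup\mathcal Z$ and edges $\{P,z\}$ with $P\in z$, with shortest-path distance $d$. A set $S$ resolves $W$ if for any two distinct $u,v\in W$ there is $s\in S$ with $d(u,s)\ne d(v,s)$. A set $S\subseteq\mathcal P\cup\mathcal Z$ is split-resolving if $S\cap\mathcal P$ resolves $\mathcal Z$ and $S\cap\mathcal Z$ resolves $\mathcal P$. *)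

(* Defs.v *)
From mathcomp Require Import all_boot.

Set Implicit Arguments.
Unset Strict Implicit.
Unset Printing Implicit Defensive.

Section Graph.
Variables (T : finType) (e : rel T).

Definition walk (n : nat) (x y : T) : bool :=
  [exists p : n.-tuple T, path e x p && (last x p == y)].

(* A shortest walk has fewer than #|T| edges, so [find] returns its length;
   for y unreachable from x it returns the out-of-range value #|T|, which
   stands for an infinite distance. *)
Definition dist (x y : T) : nat :=
  find (fun n => walk n x y) (iota 0 #|T|).

Definition resolves (S W : {set T}) : Prop :=
  forall u v, u \in W -> v \in W -> u != v ->
    exists2 s, s \in S & dist u s != dist v s.

End Graph.

Section Mobius.
Variables (P : finType) (Z : {set {set P}}).

Record mobius_plane : Prop := MobiusPlane {
  mobius_three_points : forall A B C : P, A != B -> A != C -> B != C ->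
    exists! z : {set P}, [/\ z \in Z, A \in z, B \in z & C \in z];
  mobius_tangent : forall (z : {set P}) (A B : P),
    z \in Z -> A \in z -> B \notin z ->
    exists! z' : {set P},
      [/\ z' \in Z, A \in z', B \in z' & z :&: z' = [set A]];
  mobius_has_circle : exists z, z \in Z;
  mobius_circle_ge3 : forall z, z \in Z -> 3 <= #|z|;
  mobius_point_off : forall z, z \in Z -> exists A : P, A \notin z
}.

Definition mobius_order (q : nat) : Prop := forall z, z \in Z -> #|z| = q.+1.

Definition vertex : finType := (P + {z : {set P} | z \in Z})%type.

Definition incidence : rel vertex := fun u v =>
  match u, v with
  | inl A, inr z | inr z, inl A => A \in val z
  | _, _ => false
  end.

Definition point_vertices : {set vertex} := [set inl A | A : P].

Definition circle_vertices : {set vertex} :=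
  [set inr z | z : {z : {set P} | z \in Z}].

Definition split_resolving (S : {set vertex}) : Prop :=
  resolves incidence (S :&: point_vertices) circle_vertices /\
  resolves incidence (S :&: circle_vertices) point_vertices.

Definition min_split_resolving (S : {set vertex}) : Prop :=
  split_resolving S /\
  forall S' : {set vertex}, split_resolving S' -> #|S| <= #|S'|.

End Mobius.

(* Main.v *)
Require Import Defs.
From mathcomp Require Import all_boot.

Set Implicit Arguments.
Unset Strict Implicit.
Unset Printing Implicit Defensive.

(** In a Möbius plane of order 2 the circles are exactly the 3-subsets of the
    point set, and axiom (ii) forces 5 points.  A point and a circle are at
    distance 1 or 3 according to incidence, so resolving means separating by
    incidence.  Points: if two points A, B are both missing, the circles ACD
    and BCD are not separated, whereas four points determine every 3-subset.
    Circles: k circles separate at most 2^k points, hence k >= 3, and the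
    circles abc, abd, acd separate the points a, b, c, d, e. *)

Lemma cards3 (T : finType) (x y t : T) :
  x != y -> x != t -> y != t -> #|[set x; y; t]| = 3.
Proof.
move=> xy xt yt; rewrite setUC cardsU1 cards2 xy !inE.
by rewrite ![t == _]eq_sym (negbTE xt) (negbTE yt).
Qed.

(** * Walks and distances in a finite graph *)

Lemma walk0 (T : finType) (e : rel T) x y : walk e 0 x y = (x == y).
Proof.
apply/existsP/idP => [[p]|xy]; first by rewrite tuple0.
by exists [tuple].
Qed.

Lemma walkS (T : finType) (e : rel T) n x y :
  walk e n.+1 x y = [exists w, e x w && walk e n w y].
Proof.
apply/existsP/existsP => [[p]|[w /andP[xw /existsP[p pP]]]].
  case/tupleP: p => w p /= /andP[/andP[xw pw] lw].
  by exists w; rewrite xw; apply/existsP; exists p; rewrite pw.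
by exists [tuple of w :: p]; rewrite /= xw.
Qed.

(** [dist] searches only the lengths below [#|T|], so the bound on [n] keeps the hit in range. Split
    at [n], the range has no hit in its first segment, and [n] heads the second. *)
Lemma dist_eq (T : finType) (e : rel T) n x y :
  n < #|T| -> walk e n x y -> (forall m, m < n -> ~~ walk e m x y) ->
  dist e x y = n.
Proof.
move=> ltn wn nw; rewrite /dist -(subnKC (ltnW ltn)) iotaD find_cat size_iota.
case: hasP => [[m]|_]; first by rewrite mem_iota => /nw/negbTE->.
by case: (_ - _) (subn_gt0 n #|T|) => [|k]; rewrite ltn //= wn addn0.
Qed.

(** * Circles and points of a plane of order 2 *)

Section OrderTwo.
Variables (P : finType) (Z : {set {set P}}).
Hypotheses (hM : mobius_plane Z) (hq : mobius_order Z 2).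

(** The elements of a 3-set lie on a common circle by axiom (i); that circle also has just three
    points, so it is the 3-set itself. *)
Lemma mem_circles z : (z \in Z) = (#|z| == 3).
Proof.
apply/idP/eqP => [/hq//|z3].
have /card_gt2P[x [y [t [[xz yz tz] [xy yt tx]]]]] : 2 < #|z| by rewrite z3.
rewrite eq_sym in tx.
have [w [[wZ xw yw tw] _]] := mobius_three_points hM xy tx yt.
have c3 := cards3 xy tx yt.
suff E (v : {set P}) : #|v| = 3 -> x \in v -> y \in v -> t \in v -> [set x; y; t] = v.
  by rewrite -(E z z3 xz yz tz) (E w (hq wZ) xw yw tw).
move=> v3 xv yv tv; apply/eqP; rewrite eqEcard c3 v3 andbT.
by rewrite !subUset !sub1set xv yv tv.
Qed.

Lemma circle3 x y t : x != y -> x != t -> y != t -> [set x; y; t] \in Z.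
Proof. by move=> *; rewrite mem_circles cards3. Qed.

(* All points off a circle z lie on the circle tangent to z at A through B. *)
Lemma card_points : #|P| = 5.
Proof.
have [z zZ] := mobius_has_circle hM.
have [B Bz] := mobius_point_off hM zZ.
have /card_gt0P[A Az] : 0 < #|z| by rewrite (hq zZ).
have [t [[tZ At Bt zt] tU]] := mobius_tangent hM zZ Az Bz.
have AB : A != B by apply: contraNneq Bz => <-.
(* This equality leaves 3 - 1 = 2 points off [z], hence 3 + 2 points in all. *)
suff Ez : ~: z = t :\ A.
  have := cardsC z; rewrite Ez (hq zZ) => <-.
  by have := cardsD1 A t; rewrite At (hq tZ) add1n => -[<-].
apply/setP=> X; rewrite !inE; apply/idP/andP => [Xz|[XA Xt]]; last first.
  by apply: contra XA => Xz; rewrite -in_set1 -zt inE Xz.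
have AX : A != X by apply: contraNneq Xz => <-.
split; first by rewrite eq_sym.
have [<-//|BX] := eqVneq B X.
(* The 3-set [[set A; B; X]] is a circle meeting [z] only in [A], so uniqueness of the tangent
   circle identifies it with [t]. *)
rewrite (tU [set A; B; X]) ?inE ?eqxx ?orbT //.
split; rewrite ?circle3 ?inE ?eqxx ?orbT //.
apply/setP=> Y; rewrite !inE.
have [->|_] := eqVneq Y A; first by rewrite Az.
have [->|_] := eqVneq Y B; first by rewrite (negbTE Bz).
by have [->|_] := eqVneq Y X; rewrite ?(negbTE Xz) ?andbF.
Qed.

(** * Distances in the incidence graph *)

Definition is_circle (v : vertex Z) : bool := if v is inr _ then true else false.

(** The graph is bipartite: every edge switches between points and circles. This rules out walks of
    even length between a point and a circle. *)
Lemma walk_parity n x y :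
  walk (@incidence P Z) n x y -> is_circle y = is_circle x (+) odd n.
Proof.
elim: n x => [|n IHn] x; first by rewrite walk0 addbF => /eqP->.
rewrite walkS => /existsP[w /andP[xw /IHn->]] /=.
by case: x w xw => [A|z] [B|t] //= _; case: odd.
Qed.

Lemma ex_third_point (A B : P) : exists C, (A != C) && (B != C).
Proof.
have /card_gt0P[C] : 0 < #|~: [set A; B]|.
  rewrite cardsCs setCK cards2 card_points; by case: (A != B).
by rewrite !inE negb_or ![C == _]eq_sym; exists C.
Qed.

(** Supplies the inner vertices of a walk [A], [t], [B], [z] of length 3 from any point to any
    circle. *)
Lemma point_circle_path A (z : {z | z \in Z}) : exists2 B, B \in val z &
  exists t : {t | t \in Z}, (A \in val t) && (B \in val t).
Proof.
have /card_gt0P[B] : 0 < #|val z :\ A|.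
  by have := cardsD1 A (val z); rewrite (hq (valP z)); case: (A \in _); case: #|_|.
rewrite !inE => /andP[BA Bz]; exists B => //.
have [C /andP[AC BC]] := ex_third_point A B.
have tZ : [set A; B; C] \in Z by rewrite circle3 // eq_sym.
by exists (exist (fun z => z \in Z) _ tZ); rewrite !inE !eqxx !orbT.
Qed.

Lemma dist_incidence x y : is_circle x != is_circle y ->
  dist (@incidence P Z) x y = if incidence x y then 1 else 3.
Proof.
move=> xy.
(* Lengths 1 and 3 must lie below the number of vertices to be found by [dist]. *)
have V4 : 4 < #|vertex Z| by rewrite card_sum card_points leq_addr.
have even n : ~~ odd n -> ~~ walk (@incidence P Z) n x y.
  move=> nodd; apply: contra xy => /walk_parity->.
  by rewrite (negbTE nodd) addbF.
have w1 : walk (@incidence P Z) 1 x y = incidence x y.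
  rewrite walkS; apply/existsP/idP => [[w]|h]; last by exists y; rewrite walk0 h /=.
  by rewrite walk0 => /andP[h /eqP<-].
case: ifPn => inc.
  apply: dist_eq; rewrite ?w1 //; first by apply: leq_trans V4.
  by case=> // _; apply: even.
apply: dist_eq; first by apply: leq_trans V4.
  case: x y xy {even w1 inc V4} => [A|z] [B|t] // _.
    have [C Ct [s /andP[As Cs]]] := point_circle_path A t.
    rewrite walkS; apply/existsP; exists (inr s); rewrite [incidence _ _]As.
    rewrite walkS; apply/existsP; exists (inl C); rewrite [incidence _ _]Cs.
    by rewrite walkS; apply/existsP; exists (inr t); rewrite [incidence _ _]Ct walk0 /=.
  (* From a circle to a point, the same walk is traversed backwards. *)
  have [C Cz [s /andP[Bs Cs]]] := point_circle_path B z.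
  rewrite walkS; apply/existsP; exists (inl C); rewrite [incidence _ _]Cz.
  rewrite walkS; apply/existsP; exists (inr s); rewrite [incidence _ _]Cs.
  by rewrite walkS; apply/existsP; exists (inl B); rewrite [incidence _ _]Bs walk0 /=.
by case=> [|[|[|]]] // _; rewrite ?w1 ?even.
Qed.

Lemma point_dist_neq A B (z : {z | z \in Z}) :
  (dist (@incidence P Z) (inl A) (inr z) != dist (@incidence P Z) (inl B) (inr z))
  = ((A \in val z) != (B \in val z)).
Proof. by rewrite !dist_incidence //=; do 2!case: (_ \in _). Qed.

Lemma circle_dist_neq (y z : {z | z \in Z}) A :
  (dist (@incidence P Z) (inr y) (inl A) != dist (@incidence P Z) (inr z) (inl A))
  = ((A \in val y) != (A \in val z)).
Proof. by rewrite !dist_incidence //=; do 2!case: (_ \in _). Qed.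

(** * Lower bounds for the points and the circles *)

Lemma resolving_points_ge4 (S : {set vertex Z}) :
  resolves (@incidence P Z) (S :&: point_vertices Z) (circle_vertices Z) ->
  4 <= #|S :&: point_vertices Z|.
Proof.
move=> res; rewrite leqNgt; apply/negP => S3.
have /card_gt1P[A [B [AS BS AB]]] : 1 < #|~: [set A | inl A \in S]|.
  rewrite cardsCs setCK card_points ltn_subRL addn1 ltnS.
  rewrite -(card_imset _ (inl_inj : injective (inl : P -> vertex Z))).
  apply: leq_ltn_trans S3.
  apply/subset_leq_card/subsetP=> _ /imsetP[C + ->].
  by rewrite !inE => ->; rewrite imset_f.
have /card_gt1P[C [D [CAB DAB CD]]] : 1 < #|~: [set A; B]|.
  by rewrite cardsCs setCK cards2 card_points AB.
rewrite !inE !negb_or in AS BS CAB DAB.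
case/andP: CAB => CA CB; case/andP: DAB => DA DB.
have yZ : [set A; C; D] \in Z by rewrite circle3 // eq_sym.
have zZ : [set B; C; D] \in Z by rewrite circle3 // eq_sym.
have yz : (inr (exist (fun z => z \in Z) _ yZ) : vertex Z) != inr (exist (fun z => z \in Z) _ zZ).
  apply/eqP=> -[/setP/(_ A)]; rewrite !inE eqxx (negbTE AB).
  by rewrite ![A == _]eq_sym (negbTE CA) (negbTE DA).
have [s /setIP[sS /imsetP[X _ sX]]] := res _ _ (imset_f _ isT) (imset_f _ isT) yz.
(* The two circles differ only at [A] and [B], and neither of these is in [S]. *)
rewrite sX in sS *; move: sS; rewrite circle_dist_neq /= !inE.
have [->|_] := eqVneq X A; first by rewrite (negbTE AS).
by have [->|_] := eqVneq X B; rewrite ?(negbTE BS) ?eqxx.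
Qed.

(** A point is determined by its [trace], the set of chosen circles through it, so the five points
    inject into the subsets of [C]; but 2 ^ 2 < 5. *)
Lemma resolving_circles_ge3 (S : {set vertex Z}) :
  resolves (@incidence P Z) (S :&: circle_vertices Z) (point_vertices Z) ->
  3 <= #|S :&: circle_vertices Z|.
Proof.
move=> res; set C := S :&: circle_vertices Z in res *.
pose trace A := [set s in C | incidence (inl A) s].
have trace_inj : injective trace.
  move=> A B tAB; apply/eqP; apply: contraT => AB.
  have AB' : (inl A : vertex Z) != inl B by [].
  have [s sC] := res _ _ (imset_f _ isT) (imset_f _ isT) AB'.
  have [_ /imsetP[z _ sz]] := setIP sC.
  have /setP/(_ s) := tAB; rewrite ![s \in trace _]inE sC sz point_dist_neq /=.
  by move=> ->; rewrite eqxx.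
have : #|P| <= #|powerset C|.
  rewrite -(card_imset _ trace_inj) subset_leq_card //.
  apply/subsetP=> _ /imsetP[A _ ->].
  by rewrite inE; apply/subsetP=> s; rewrite inE => /andP[].
rewrite card_points card_powerset.
by case: #|C| => [|[|[|]]].
Qed.

(** * A split-resolving set with four points and three circles *)

Lemma ex_split_resolving7 : exists2 S : {set vertex Z},
  split_resolving S & #|S| <= 7.
Proof.
have: size (enum P) = 5 by rewrite -cardE card_points.
have := enum_uniq P; have := mem_enum P.
case: (enum P) => [|a [|b [|c [|d [|e []]]]]] // inP + _.
rewrite /= !inE !negb_or => /and5P[/and4P[ab ac ad ae] /and3P[bc bd be] /andP[cd ce] de _].
(* The incidences with [y], [z], [t] are 111 for [a], 110 for [b], 101 for [c], 011 for [d] and 000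
   for [e], which are pairwise distinct. *)
pose y := exist (fun z => z \in Z) _ (circle3 ab ac bc).
pose z := exist (fun z => z \in Z) _ (circle3 ab ad bd).
pose t := exist (fun z => z \in Z) _ (circle3 ac ad cd).
exists [set v in [:: inl a; inl b; inl c; inl d; inr y; inr z; inr t]]; last first.
  by rewrite cardsE card_size.
split=> _ _ /imsetP[u _ ->] /imsetP[v _ ->] uv; last first.
  suff [w wS uvw] : exists2 w, w \in [:: y; z; t] & (u \in val w) != (v \in val w).
    exists (inr w); last by rewrite point_dist_neq.
    rewrite !inE imset_f // andbT.
    by move: wS; rewrite !inE => /or3P[]/eqP->; rewrite eqxx ?orbT.
  have {}uv : u != v by [].
  have [/eqP uvy|] := boolP ((u \in val y) == (v \in val y)); last by exists y => //; rewrite !inE eqxx ?orbT.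
  have [/eqP uvz|] := boolP ((u \in val z) == (v \in val z)); last by exists z => //; rewrite !inE eqxx ?orbT.
  have [/eqP uvt|] := boolP ((u \in val t) == (v \in val t)); last by exists t => //; rewrite !inE eqxx ?orbT.
  move: uv uvy uvz uvt (inP u) (inP v); rewrite /= !inE.
  pose neqs := (negbTE ab, negbTE ac, negbTE ad, negbTE ae, negbTE bc, negbTE bd, negbTE be,
                negbTE cd, negbTE ce, negbTE de).
  have neqs' := (eq_sym b a, eq_sym c a, eq_sym d a, eq_sym e a, eq_sym c b, eq_sym d b,
                 eq_sym e b, eq_sym d c, eq_sym e c, eq_sym e d).
  move=> uv uvy uvz uvt /or4P[|||/orP[]] /eqP ? /or4P[|||/orP[]] /eqP ?; subst u v;
    by move: uv uvy uvz uvt; rewrite ?neqs' ?neqs ?eqxx.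
have {}uv : u != v by [].
have [/existsP[s /andP[se uvs]]|sep] :=
  boolP [exists s, (s != e) && ((s \in val u) != (s \in val v))].
  exists (inl s); last by rewrite circle_dist_neq.
  have := inP s; rewrite !inE (negbTE se) imset_f // andbT orbF => /or4P[] /eqP->;
  by rewrite eqxx ?orbT.
have eq_off s : s != e -> (s \in val u) = (s \in val v).
  by move=> se; have /existsPn/(_ s) := sep; rewrite se negbK => /eqP.
have eqD : val u :\ e = val v :\ e.
  by apply/setP=> s; rewrite !inE; case: eqVneq => //= /eq_off.
(* The circles agree off [e], the only point left out of the set; having equally many points, they
   also agree at [e]. *)
case/eqP: uv; apply/val_inj/setP => s; have [->|/eq_off//] := eqVneq s e.
have := cardsD1 e (val u); rewrite eqD (hq (valP u)) -(hq (valP v)).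
by rewrite (cardsD1 e (val v)) => /addIn; do 2!case: (_ \in _).
Qed.

End OrderTwo.

Theorem mainTheorem11 (P : finType) (Z : {set {set P}})
    (hM : mobius_plane Z) (hq : mobius_order Z 2)
    (S : {set vertex Z}) (hS : min_split_resolving S) :
  #|S :&: point_vertices Z| = 4 /\ #|S :&: circle_vertices Z| = 3.
Proof.
case: hS => -[resZ resP] minS.
have [S' splitS' S'7] := ex_split_resolving7 hM hq.
have p4 := resolving_points_ge4 hM hq resZ.
have c3 := resolving_circles_ge3 hM hq resP.
(* Points and circles partition the vertices, so [#|S|] is the sum of the two cardinalities. *)
have cvE : S :&: circle_vertices Z = S :\: point_vertices Z.
  apply/setP=> -[A|z]; rewrite !inE.
    rewrite imset_f // andbC; suff /negbTE-> : inl A \notin circle_vertices Z by [].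
    by apply/imsetP=> -[].
  rewrite imset_f // andbC; suff -> : inr z \notin point_vertices Z by [].
  by apply/imsetP=> -[].
have := leq_trans (minS _ splitS') S'7.
rewrite -(cardsID (point_vertices Z) S) -cvE => le7.
(* With the sum at most 7 and the summands at least 4 and 3, both bounds are attained. *)
split; apply/eqP; rewrite eqn_leq ?p4 ?c3 andbT.
  by rewrite -(leq_add2r 3) (leq_trans _ le7) // leq_add2l.
by rewrite -(leq_add2l 4) (leq_trans _ le7) // leq_add2r.
Qed.
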